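(* If $h>h_1=0.560771160\dots$, then the delayed KPP-Fisher equation $$u_t(t,x)=\Delta u(t,x)+u(t,x)(1-u(t-h,x)),\quad u\ge0,\ x\in\mathbb{R}^m,$$ does not have any positive monotone traveling wavefront.
   Context: $h_1$ is the positive root of $2h^2\exp(1+\sqrt{1+4h^2}-2h)=1+\sqrt{1+4h^2}$. A wavefront is a classical solution $u(t,x)=\varphi(\nu\cdot x+ct)$, $|\nu|=1$, with speed $c>0$ and positive profile $\varphi$ satisfying $\varphi(-\infty)=0$, $\varphi(+\infty)=1$; it is monotone if $\varphi$ is monotone. *)

(* Defs.v *)
From HB Require Import structures.
From mathcomp Require Import all_boot all_order all_algebra.
From mathcomp Require Import all_classical all_reals all_analysis.

Set Implicit Arguments.
Unset Strict Implicit.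
Unset Printing Implicit Defensive.

Import Order.TTheory GRing.Theory Num.Theory.
Import numFieldNormedType.Exports.

Local Open Scope classical_set_scope.
Local Open Scope ring_scope.

Definition dot (R : realType) (m : nat) (v w : 'rV[R]_m) : R :=
  \sum_(i < m) v 0 i * w 0 i.

(* The library norm on 'rV[R]_m is the sup norm, whereas directions of
   propagation are normalized in the Euclidean norm. *)
Definition enorm (R : realType) (m : nat) (v : 'rV[R]_m) : R :=
  Num.sqrt (dot v v).

Definition dt (R : realType) (m : nat) (u : R -> 'rV[R]_m -> R)
    (t : R) (x : 'rV[R]_m) : R :=
  'D_1 (fun s : R => u s x) t.

Definition partial (R : realType) (m : nat) (i : 'I_m) (f : 'rV[R]_m -> R)
    (x : 'rV[R]_m) : R :=
  'D_(delta_mx 0 i) f x.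

Definition laplacian (R : realType) (m : nat) (f : 'rV[R]_m -> R)
    (x : 'rV[R]_m) : R :=
  \sum_(i < m) partial i (partial i f) x.

(* Derivatives are total in the library (junk value when the limit does not
   exist), so existence is required separately from continuity; continuity is
   joint in (t, x). *)
Record is_C12 (R : realType) (m : nat) (u : R -> 'rV[R]_m -> R) : Prop := IsC12 {
  C12_ex_dt : forall t x, derivable (fun s : R => u s x) t 1;
  C12_ex_dx : forall t x i, derivable (u t) x (delta_mx 0 i);
  C12_ex_dxx : forall t x i j, derivable (partial i (u t)) x (delta_mx 0 j);
  C12_cont : continuous (fun p : R * 'rV[R]_m => u p.1 p.2);
  C12_cont_dt : continuous (fun p : R * 'rV[R]_m => dt u p.1 p.2);
  C12_cont_dx : forall i,
    continuous (fun p : R * 'rV[R]_m => partial i (u p.1) p.2);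
  C12_cont_dxx : forall i j,
    continuous (fun p : R * 'rV[R]_m => partial j (partial i (u p.1)) p.2)
}.

Record kpp_solution (R : realType) (m : nat) (h : R)
    (u : R -> 'rV[R]_m -> R) : Prop := KppSolution {
  kpp_C12 : is_C12 u;
  kpp_ge0 : forall t x, 0 <= u t x;
  kpp_eq : forall t x,
    dt u t x = laplacian (u t) x + u t x * (1 - u (t - h) x)
}.

Record kpp_wavefront (R : realType) (m : nat) (h : R)
    (u : R -> 'rV[R]_m -> R) (nu : 'rV[R]_m) (c : R) (phi : R -> R) : Prop :=
  KppWavefront {
  wf_sol : kpp_solution h u;
  wf_profile : forall t x, u t x = phi (dot nu x + c * t);
  wf_dir : enorm nu = 1;
  wf_speed : 0 < c;
  wf_pos : forall z, 0 < phi z;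
  wf_left : phi z @[z --> -oo] --> (0 : R);
  wf_right : phi z @[z --> +oo] --> (1 : R)
}.

Definition monotone_profile (R : realType) (phi : R -> R) : Prop :=
  {homo phi : x y / x <= y} \/ {homo phi : x y /~ x <= y}.

Definition has_monotone_wavefront (R : realType) (m : nat) (h : R) : Prop :=
  exists (u : R -> 'rV[R]_m -> R) (nu : 'rV[R]_m) (c : R) (phi : R -> R),
    kpp_wavefront h u nu c phi /\ monotone_profile phi.

Definition h1_root (R : realType) (h : R) : Prop :=
  0 < h /\
  2 * h ^+ 2 * expR (1 + Num.sqrt (1 + 4 * h ^+ 2) - 2 * h)
    = 1 + Num.sqrt (1 + 4 * h ^+ 2).

(* Main.v *)
Require Import Defs.
From HB Require Import structures.
From mathcomp Require Import all_boot all_order all_algebra.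
From mathcomp Require Import all_classical all_reals all_analysis.
From mathcomp Require Import ring lra.

Import Order.TTheory GRing.Theory Num.Theory.
Import numFieldNormedType.Exports.

Local Open Scope classical_set_scope.
Local Open Scope ring_scope.


(** The profile phi of a wavefront solves
      phi'' = c phi' - phi (1 - phi(. - tau)),   tau = c h,
    and, being positive with limits 0 and 1, it can only be increasing
    ([wavefront_profile]).  Two facts about increasing profiles collide when
    h > h1.

    At -oo the linearization phi'' - c phi' + phi = 0 oscillates if c < 2,
    which positivity forbids; hence c >= 2 ([front_speed_ge2]).

    At +oo the deviation q = 1 - phi > 0 satisfies q'' = c q' + phi q(. - tau).
    If q' <= - lambda q near +oo, then q(t - tau) >= exp(lambda tau) q(t), so
    q'' - c q' >= K q with K slightly below exp(lambda tau); the operator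
    D^2 - c D - (beta^2 + c beta) factors as (D - (c + beta)) (D + beta), and
    boundedness of q then forces q' <= - beta q whenever
    beta^2 + c beta <= K ([front_decay_iterate]).  Were
    mu^2 + c mu <= theta exp(mu tau) for all mu >= 0 and some theta < 1, each
    such step would raise the decay rate by a fixed amount, without end.  But q
    obeys a Harnack inequality q(t) >= k q(t - tau/4), which bounds the decay
    rates ([front_decay_bounded]).  So the characteristic function
    mu^2 + c mu - theta exp(mu tau) is positive somewhere, for each theta < 1
    ([front_characteristic_root]).

    With z = c mu and c >= 2 this gives z >= 0 with
    z^2/4 + z > theta exp(z h).  The number h1 is the delay for which the graph
    of exp(z h1) is tangent to that of z^2/4 + z; since the logarithm of the
    latter is concave, z^2/4 + z <= exp(z h1) for all z >= 0
    ([tangent_bound]), and h > h1 leaves room for a theta < 1.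

    The tangency is solved in the variable q = sqrt(1 + 4 h^2) - 2 h of (0, 1),
    in which the equation of h1 becomes (1 - q)^2 exp(1 + q) = 4 q: the left
    side decreases, the right side increases, so the root is unique, and Taylor
    bounds at two rationals locate it. *)

(** * Derivatives and differential inequalities *)

Section Calculus.
Set Implicit Arguments.
Unset Strict Implicit.
Variable R : realType.
Implicit Types (f g : R -> R) (x a b : R).

Lemma is_derive_add f g x a b : is_derive x 1 f a -> is_derive x 1 g b ->
  is_derive x 1 (fun t => f t + g t) (a + b).
Proof. by move=> fa gb; exact: is_deriveD. Qed.

Lemma is_derive_sub f g x a b : is_derive x 1 f a -> is_derive x 1 g b ->
  is_derive x 1 (fun t => f t - g t) (a - b).
Proof. by move=> fa gb; exact: is_deriveB. Qed.

Lemma is_derive_mul f g x a b : is_derive x 1 f a -> is_derive x 1 g b ->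
  is_derive x 1 (fun t => f t * g t) (a * g x + f x * b).
Proof.
move=> fa gb; apply: (@is_derive_eq _ _ _ _ _ _ _ _ (is_deriveM fa gb)).
by rewrite /GRing.scale /= addrC mulrC.
Qed.

Lemma is_derive_const k x : is_derive x 1 (fun=> k : R) 0.
Proof. exact: is_derive_cst. Qed.

Lemma is_derive_scale f k x a : is_derive x 1 f a ->
  is_derive x 1 (fun t => k * f t) (k * a).
Proof.
move=> fa; apply: (is_derive_eq (is_derive_mul (is_derive_const k x) fa)).
by rewrite mul0r add0r.
Qed.

Lemma is_derive_affine (k d x : R) : is_derive x 1 (fun t => k * t + d) k.
Proof.
have kx := is_derive_scale k (is_derive_id x (1 : R)).
apply: (is_derive_eq (is_derive_add kx (is_derive_const d x))).
by rewrite addr0 mulr1.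
Qed.

Lemma is_derive_comp_affine f (k d x a : R) : is_derive (k * x + d) 1 f a ->
  is_derive x 1 (fun t => f (k * t + d)) (k * a).
Proof.
move=> fa; rewrite mulrC.
exact: (@is_derive1_comp _ _ (fun t => k * t + d) _ _ _ fa (is_derive_affine k d x)).
Qed.

Lemma ndecr_of_is_derive f (df : R -> R) (a b : R) : a <= b ->
  (forall x, a <= x <= b -> is_derive x 1 f (df x)) ->
  (forall x, a <= x <= b -> 0 <= df x) -> f a <= f b.
Proof.
move=> ab fdf df0.
have [||x xab E] := @MVT_segment R f df a b ab.
- by move=> x; rewrite in_itv /= => /andP[/ltW ax /ltW xb]; apply: fdf; rewrite ax.
- apply: derivable_within_continuous => x; rewrite in_itv /= => xab.
  exact: (@ex_derive _ _ _ _ _ _ _ (fdf x xab)).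
- by rewrite -subr_ge0 E mulr_ge0 ?subr_ge0 // df0.
Qed.

Lemma ler_of_is_derive f g (df dg : R -> R) (a b : R) : a <= b ->
  (forall x, a <= x <= b -> is_derive x 1 f (df x)) ->
  (forall x, a <= x <= b -> is_derive x 1 g (dg x)) ->
  (forall x, a <= x <= b -> df x <= dg x) -> g a - f a <= g b - f b.
Proof.
move=> ab fdf gdg le.
apply: (@ndecr_of_is_derive (fun t => g t - f t) (fun t => dg t - df t)) => // x xab.
  by apply: is_derive_sub; [exact: gdg | exact: fdf].
by rewrite subr_ge0 le.
Qed.

(** Multiply by the integrating factor exp(- k t). *)
Lemma gronwall_lower (y dy : R -> R) (k a b : R) : a <= b ->
  (forall t, a <= t <= b -> is_derive t 1 y (dy t)) ->
  (forall t, a <= t <= b -> k * y t <= dy t) ->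
  y a * expR (k * (b - a)) <= y b.
Proof.
move=> ab ydy le.
have := @ndecr_of_is_derive (fun t => y t * expR (- k * t + k * b))
  (fun t => (dy t - k * y t) * expR (- k * t + k * b)) _ _ ab.
have -> : - k * b + k * b = 0 by ring.
have -> : - k * a + k * b = k * (b - a) by ring.
rewrite expR0 mulr1; apply => t tab.
  have de := is_derive_comp_affine (is_derive_expR (- k * t + k * b)).
  apply: (is_derive_eq (is_derive_mul (ydy t tab) de)).
  by ring.
by rewrite mulr_ge0 ?expR_ge0 // subr_ge0 le.
Qed.

Lemma is_derive_ge0 f x a : {homo f : u v / u <= v} -> is_derive x 1 f a -> 0 <= a.
Proof.
move=> fm [fd <-]; apply: limr_ge => //; near=> h.
have : h != 0 by near: h; exact: nbhs_dnbhs_neq.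
rewrite neq_lt /GRing.scale /= mulr1 => /orP[h0|h0].
- by rewrite nmulr_rge0 ?invr_lt0 // subr_le0 fm // gerDr ltW.
- by rewrite pmulr_rge0 ?invr_gt0 // subr_ge0 fm // lerDr ltW.
Unshelve. all: by end_near. Qed.

End Calculus.

(** * Increasing solutions of the profile equation *)

Section Front.
Set Implicit Arguments.
Unset Strict Implicit.
Variable R : realType.

(** The derivatives are carried as explicit functions so that the equation can
    be used algebraically; [tau] is the delay seen by the profile, that is the
    speed times the delay of the partial differential equation. *)
Record increasing_front (c tau : R) (p p1 p2 : R -> R) : Prop := IncreasingFront {
  front_c_gt0 : 0 < c;
  front_tau_gt0 : 0 < tau;
  front_d1 : forall t : R, is_derive t 1 p (p1 t);
  front_d2 : forall t : R, is_derive t 1 p1 (p2 t);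
  front_eq : forall t, p2 t = c * p1 t - p t * (1 - p (t - tau));
  front_mono : {homo p : x y / x <= y};
  front_gt0 : forall t, 0 < p t;
  front_left : p z @[z --> -oo] --> (0 : R);
  front_right : p z @[z --> +oo] --> (1 : R)
}.

Implicit Types (c tau : R) (p : R -> R).

Lemma front_slope_ge0 c tau p p1 p2 (F : increasing_front c tau p p1 p2) t : 0 <= p1 t.
Proof. exact: is_derive_ge0 (front_mono F) (front_d1 F t). Qed.

Lemma front_le1 c tau p p1 p2 (F : increasing_front c tau p p1 p2) t : p t <= 1.
Proof.
rewrite leNgt; apply/negP => pt.
have [M [_ Mp]] := @cvgr_lt _ _ _ _ _ _ (front_right F) _ pt.
have := Mp (Num.max t (M + 1)).
rewrite lt_max ltrDl ltr01 orbT => /(_ isT).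
by rewrite ltNge (front_mono F) // le_max lexx.
Qed.

Lemma front_eventually_le c tau p p1 p2
    (F : increasing_front c tau p p1 p2) (e : R) : 0 < e ->
  exists T, forall t, t <= T -> p t <= e.
Proof.
move=> e0; have [M [_ Mp]] := @cvgr_lt _ _ _ _ _ _ (front_left F) _ e0.
exists (M - 1) => t tM; apply/ltW/Mp; lra.
Qed.

Lemma front_eventually_ge c tau p p1 p2
    (F : increasing_front c tau p p1 p2) (k : R) : k < 1 ->
  exists T, forall t, T <= t -> k <= p t.
Proof.
move=> k1; have [M [_ Mp]] := @cvgr_gt _ _ _ _ _ _ (front_right F) _ k1.
exists (M + 1) => t tM; apply/ltW/Mp; lra.
Qed.

(** If c < 2, the function w = phi / (phi + phi') stays in (0, 1], while
    w' (phi + phi')^2 = phi'^2 - c phi phi' + phi^2 (1 - phi(. - tau)) is close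
    to a positive definite quadratic form in (phi, phi') near -oo.  So w' is
    bounded below by a positive constant on a left half-line, which is absurd. *)
Lemma front_speed_ge2 c tau p p1 p2 (F : increasing_front c tau p p1 p2) : 2 <= c.
Proof.
have c_gt0 := front_c_gt0 F; have tau_gt0 := front_tau_gt0 F.
have dp := front_d1 F; have dp1 := front_d2 F; have p_gt0 := front_gt0 F.
rewrite leNgt; apply/negP => c2.
have c2' : 0 < (2 - c) * (2 + c) by apply: mulr_gt0; lra.
(* The quadratic form at -oo has discriminant c^2 - 4 < 0; e spends half of
   the gap on the delayed term. *)
pose e := (1 - c ^+ 2 / 4) / 2.
have e0 : 0 < e by rewrite /e; lra.
have e1 : e <= 1 / 2 by have := sqr_ge0 c; rewrite /e; lra.
have [T pT] := front_eventually_le F e0.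
pose w t := p t / (p t + p1 t).
have w01 t : 0 < w t <= 1.
  have := p_gt0 t; have := front_slope_ge0 F t => p1t pt.
  have pp : 0 < p t + p1 t by lra.
  by rewrite /w divr_gt0 //= ler_pdivrMr // mul1r; lra.
(* At slope e / 8, a length L makes w vary by 2. *)
pose L := 16 / e.
have L0 : 0 < L by rewrite divr_gt0.
have TL : T - L <= T by lra.
have E8 : e / 8 * L = 2 by rewrite /L; field; rewrite gt_eqF.
have := w01 T; have := w01 (T - L).
suff : e / 8 * L <= w T - w (T - L) by lra.
have -> : e / 8 * L = (e / 8 * T + 0) - (e / 8 * (T - L) + 0) by ring.
suff : w (T - L) - (e / 8 * (T - L) + 0) <= w T - (e / 8 * T + 0) by lra.
apply: (@ler_of_is_derive R (fun t => e / 8 * t + 0) w (fun=> e / 8)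
  (fun t => (p1 t ^+ 2 - p t * p2 t) / (p t + p1 t) ^+ 2)) => // t.
- by move=> _; exact: is_derive_affine.
- move=> _; have := p_gt0 t; have := front_slope_ge0 F t => p1t pt.
  have pp : p t + p1 t != 0 by rewrite gt_eqF //; lra.
  have dI : is_derive t 1 (fun t => (p t + p1 t)^-1)
      (- (p t + p1 t) ^- 2 * (p1 t + p2 t)).
    exact: (@is_deriveV _ (fun t => p t + p1 t) t _ 1 pp (is_derive_add (dp t) (dp1 t))).
  apply: (is_derive_eq (is_derive_mul (dp t) dI)).
  by field.
- move=> /andP[_ tT]; have := p_gt0 t; have := front_slope_ge0 F t => p1t pt.
  have pp : 0 < p t + p1 t by lra.
  rewrite ler_pdivlMr ?exprn_gt0 // (front_eq F).
  have pe : p (t - tau) <= e by apply: pT; lra.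
  pose a := p1 t - c / 2 * p t.
  have -> : p1 t ^+ 2 - p t * (c * p1 t - p t * (1 - p (t - tau))) =
      a ^+ 2 + (2 * e - p (t - tau)) * p t ^+ 2 by rewrite /a /e; field.
  have -> : p t + p1 t = a + (1 + c / 2) * p t by rewrite /a; ring.
  apply: (@le_trans _ _ (a ^+ 2 + e * p t ^+ 2)).
    have k4 : (1 + c / 2) ^+ 2 <= 4 by lra.
    have sq : (a + (1 + c / 2) * p t) ^+ 2 <= 2 * a ^+ 2 + 8 * p t ^+ 2.
      have : 0 <= (a - (1 + c / 2) * p t) ^+ 2 by exact: sqr_ge0.
      have : (1 + c / 2) ^+ 2 * p t ^+ 2 <= 4 * p t ^+ 2 by rewrite ler_wpM2r ?sqr_ge0.
      by lra.
    have : e / 8 * (a + (1 + c / 2) * p t) ^+ 2 <= e / 8 * (2 * a ^+ 2 + 8 * p t ^+ 2).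
      by rewrite ler_wpM2l //; lra.
    have : 0 <= (1 - e / 4) * a ^+ 2.
      by rewrite mulr_ge0 ?sqr_ge0 //; lra.
    lra.
  by rewrite lerD2l ler_wpM2r ?sqr_ge0 //; lra.
Qed.

(** On [t, t + tau/2] the delayed deviation is at least A = 1 - phi(t - tau/2), so
    y = phi(a) A / c - phi' satisfies y' >= c y; growing at rate c, it must start
    low enough to stay below phi(a) A / c. *)
Lemma front_slope_lower c tau p p1 p2 (F : increasing_front c tau p p1 p2)
    (a t : R) : a <= t ->
  p a / c * (1 - expR (- (c * (tau / 2)))) * (1 - p (t - tau / 2)) <= p1 t.
Proof.
move=> at_.
have c0 := front_c_gt0 F; have tau0 := front_tau_gt0 F.
set B := p a / c * (1 - p (t - tau / 2)).
have tt : t <= t + tau / 2 by lra.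
have := @gronwall_lower R (fun s => - 1 * p1 s + B) (fun s => -1 * p2 s + 0) c _ _ tt.
have -> : t + tau / 2 - t = tau / 2 by ring.
have e0 := expR_gt0 (c * (tau / 2)).
have p10 := front_slope_ge0 F (t + tau / 2).
move=> H; have {H} : (- 1 * p1 t + B) * expR (c * (tau / 2)) <= B.
  apply: (@le_trans _ _ (- 1 * p1 (t + tau / 2) + B)); last by lra.
  apply: H => s /andP[ts st].
    exact: is_derive_add (is_derive_scale (- 1) (front_d2 F s)) (is_derive_const B s).
  rewrite (front_eq F).
  have pas : p a <= p s by apply: (front_mono F); lra.
  have pst : p (s - tau) <= p (t - tau / 2) by apply: (front_mono F); lra.
  have pt1 := front_le1 F (t - tau / 2).
  have pa0 := front_gt0 F a.
  have : p a * (1 - p (t - tau / 2)) <= p s * (1 - p (s - tau)).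
    by apply: ler_pM; lra.
  have -> : c * (-1 * p1 s + B) = p a * (1 - p (t - tau / 2)) - c * p1 s.
    by rewrite /B; field; rewrite gt_eqF.
  lra.
rewrite -ler_pdivlMr // expRN => H.
have -> : p a / c * (1 - (expR (c * (tau / 2)))^-1) * (1 - p (t - tau / 2)) =
   B - B / expR (c * (tau / 2)) by rewrite /B; ring.
lra.
Qed.

(** The previous bound, integrated over [t, t + tau/4]. *)
Lemma front_harnack c tau p p1 p2 (F : increasing_front c tau p p1 p2)
    (a : R) :
  exists2 k, 0 < k & forall t, a <= t -> k * (1 - p (t - tau / 4)) <= 1 - p t.
Proof.
have c0 := front_c_gt0 F; have tau0 := front_tau_gt0 F.
set k := p a / c * (1 - expR (- (c * (tau / 2)))).
have k0 : 0 < k.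
  rewrite mulr_gt0 ?divr_gt0 ?(front_gt0 F) // subr_gt0 expR_lt1 oppr_lt0.
  by rewrite mulr_gt0 // divr_gt0.
exists (tau / 4 * k) => [|t at_]; first by rewrite mulr_gt0 // divr_gt0.
have tt : t <= t + tau / 4 by lra.
have := @ler_of_is_derive R (fun s => k * (1 - p (t - tau / 4)) * s + 0) p
  (fun=> k * (1 - p (t - tau / 4))) p1 _ _ tt (fun=> fun=> is_derive_affine _ _ _)
  (fun s => fun=> front_d1 F s).
have p1' := front_le1 F (t + tau / 4).
move=> H; suff H0 : forall x : R, t <= x <= t + tau / 4 ->
    k * (1 - p (t - tau / 4)) <= p1 x by have := H H0; lra.
move=> s /andP[ts st].
apply: le_trans (front_slope_lower F (le_trans at_ ts)).
rewrite ler_wpM2l ?(ltW k0) // lerD2l lerN2.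
by apply: (front_mono F); lra.
Qed.

(** The Harnack inequality propagates 1 - phi > 0 from a left half-line, where
    phi <= 1/2, by steps of tau/4. *)
Lemma front_lt1 c tau p p1 p2 (F : increasing_front c tau p p1 p2) (t : R) :
  p t < 1.
Proof.
have tau0 := front_tau_gt0 F.
have [b pb] := @front_eventually_le _ _ _ _ _ F (1 / 2) ltac:(lra).
have [k k0 kb] := front_harnack F b.
have pn n : p (b + n%:R * (tau / 4)) < 1.
  elim: n => [|n IH]; first by rewrite mul0r addr0; have := pb b (lexx b); lra.
  have : b <= b + n.+1%:R * (tau / 4).
    by rewrite lerDl mulr_ge0 // divr_ge0 // ltW.
  move/kb.
  have -> : b + n.+1%:R * (tau / 4) - tau / 4 = b + n%:R * (tau / 4).
    by rewrite -natr1; ring.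
  move=> H; rewrite -subr_gt0; apply: lt_le_trans H.
  by rewrite mulr_gt0 // subr_gt0.
have [n tn] : exists n : nat, t <= b + n%:R * (tau / 4).
  exists (Num.bound (`|t - b| / (tau / 4))).
  have := @archi_boundP R (`|t - b| / (tau / 4)) ltac:(rewrite divr_ge0 //; lra).
  by rewrite ltr_pdivrMr; [have := ler_norm (t - b); lra | lra].
exact: le_lt_trans (front_mono F tn) (pn n).
Qed.

(** Put y = q' + beta q.  The inequality reads y' >= (c + beta) y, so if y were
    positive somewhere it would exceed every bound, whereas y <= beta. *)
Lemma decay_factor (c K beta T : R) (q q1 q2 : R -> R) :
    0 < c -> 0 <= beta -> beta ^+ 2 + c * beta <= K ->
    (forall t : R, is_derive t 1 q (q1 t)) ->
    (forall t : R, is_derive t 1 q1 (q2 t)) ->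
    (forall t, 0 <= q t <= 1) -> (forall t, q1 t <= 0) ->
    (forall t, T <= t -> c * q1 t + K * q t <= q2 t) ->
  forall t, T <= t -> q1 t <= - beta * q t.
Proof.
move=> c0 b0 bK dq dq1 q01 q10 ineq t Tt.
rewrite leNgt; apply/negP => yt0.
set y := q1 t + beta * q t.
have y0 : 0 < y by rewrite /y; lra.
have al0 : 0 < c + beta by lra.
have tL : t <= t + beta / y / (c + beta).
  by rewrite lerDl !divr_ge0 // ltW.
have := @gronwall_lower R (fun s => q1 s + beta * q s)
  (fun s => q2 s + beta * q1 s) (c + beta) _ _ tL.
rewrite -/y.
have -> : (c + beta) * (t + beta / y / (c + beta) - t) = beta / y.
  by field; rewrite !gt_eqF.
(* Over a time beta / (y (c + beta)), y grows past the bound beta of q' + beta q. *)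
have yE : y * expR (beta / y) >= y + beta.
  have -> : y + beta = y * (1 + beta / y) by field; rewrite gt_eqF.
  by rewrite ler_wpM2l ?(ltW y0) // expR_ge1Dx.
have := q10 (t + beta / y / (c + beta)).
have := q01 (t + beta / y / (c + beta)).
set X := q1 _; set Y := q _ => /andP[Y0 Y1] X0.
have : beta * Y <= beta by rewrite ler_piMr.
move=> bY H.
suff : y * expR (beta / y) <= X + beta * Y by lra.
apply: H => s /andP[ts _].
have := ineq s (le_trans Tt ts); have /andP[qs0 _] := q01 s.
have : (beta ^+ 2 + c * beta) * q s <= K * q s by rewrite ler_wpM2r.
by rewrite expr2; lra.
Qed.

(** A decay rate lambda of 1 - phi enlarges the delayed term by
    exp(lambda tau), which in turn improves the decay rate. *)
Lemma front_decay_iterate c tau p p1 p2 (F : increasing_front c tau p p1 p2)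
    (kappa lambda beta : R) : kappa < 1 -> 0 <= lambda -> 0 <= beta ->
    beta ^+ 2 + c * beta <= kappa * expR (lambda * tau) ->
    (exists T, forall t, T <= t -> lambda * (1 - p t) <= p1 t) ->
  exists T, forall t, T <= t -> beta * (1 - p t) <= p1 t.
Proof.
move=> k1 l0 b0 bk [T HT].
have c0 := front_c_gt0 F; have tau0 := front_tau_gt0 F.
have [T0 HT0] := front_eventually_ge F k1.
set K := kappa * expR (lambda * tau) in bk *.
exists (Num.max T T0 + tau) => t Tt.
suff : -1 * p1 t <= - beta * (-1 * p t + 1) by lra.
apply: (@decay_factor c K beta (Num.max T T0 + tau) (fun t => -1 * p t + 1)
  (fun t => -1 * p1 t) (fun t => -1 * p2 t)) => // {Tt} {}t.
- apply: (is_derive_eq (is_derive_add (is_derive_scale (- 1) (front_d1 F t))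
    (is_derive_const 1 t))).
  by rewrite addr0.
- exact: is_derive_scale (front_d2 F t).
- by have := front_gt0 F t; have := front_le1 F t; lra.
- by have := front_slope_ge0 F t; lra.
rewrite -lerBrDr ge_max => /andP[Tt T0t].
have tt : t - tau <= t by lra.
have dq (s : R) : is_derive s 1 (fun t => p t - 1) (p1 s - 0).
  exact: is_derive_sub (front_d1 F s) (is_derive_const 1 s).
have := @gronwall_lower R (fun s => p s - 1)
  (fun s => p1 s - 0) (- lambda) _ _ tt (fun s => fun=> dq s).
have -> : - lambda * (t - (t - tau)) = - (lambda * tau) by ring.
rewrite expRN => H.
have e0 := expR_gt0 (lambda * tau).
have {}H : expR (lambda * tau) * (1 - p t) <= 1 - p (t - tau).
  rewrite mulrC -ler_pdivlMr //.
  have -> : (1 - p (t - tau)) / expR (lambda * tau) =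
    - ((p (t - tau) - 1) / expR (lambda * tau)) by ring.
  suff : forall s, t - tau <= s <= t -> - lambda * (p s - 1) <= p1 s - 0.
    by move=> /H; lra.
  by move=> s /andP[ts _]; have := HT s (le_trans Tt ts); lra.
have kp : kappa <= p t by apply: HT0; lra.
have q0 : 0 <= 1 - p t by have := front_le1 F t; lra.
rewrite (front_eq F).
have : kappa * (expR (lambda * tau) * (1 - p t)) <= p t * (1 - p (t - tau)).
  apply: (@le_trans _ _ (p t * (expR (lambda * tau) * (1 - p t)))).
    by rewrite ler_wpM2r // mulr_ge0 // ltW.
  by rewrite ler_wpM2l // ltW // (front_gt0 F).
by rewrite /K; lra.
Qed.

(** A decay rate lambda contracts 1 - phi by exp(- lambda tau / 4) over a time
    tau/4, and the Harnack constant bounds this contraction. *)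
Lemma front_decay_bounded c tau p p1 p2 (F : increasing_front c tau p p1 p2) :
  exists2 M, 0 < M & forall lambda, 0 <= lambda ->
    (exists T, forall t, T <= t -> lambda * (1 - p t) <= p1 t) -> lambda <= M.
Proof.
have tau0 := front_tau_gt0 F.
have [k k0 Hk] := front_harnack F 0.
exists (4 / (k * tau)) => [|lambda l0 [T HT]]; first by rewrite divr_gt0 // mulr_gt0.
pose t := Num.max 0 T + tau / 4.
have [t0 tT] : 0 <= t - tau / 4 /\ T <= t - tau / 4.
  have : 0 <= Num.max 0 T by rewrite le_max lexx.
  have : T <= Num.max 0 T by rewrite le_max lexx orbT.
  by rewrite /t; lra.
have tt : t - tau / 4 <= t by lra.
have dq (s : R) : is_derive s 1 (fun t => p t - 1) (p1 s - 0).
  exact: is_derive_sub (front_d1 F s) (is_derive_const 1 s).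
have := @gronwall_lower R (fun s => p s - 1)
  (fun s => p1 s - 0) (- lambda) _ _ tt (fun s => fun=> dq s).
have -> : - lambda * (t - (t - tau / 4)) = - (lambda * (tau / 4)) by ring.
rewrite expRN => H.
have {}H : - (1 - p (t - tau / 4)) / expR (lambda * (tau / 4)) <= - (1 - p t).
  suff : forall s, t - tau / 4 <= s <= t -> - lambda * (p s - 1) <= p1 s - 0.
    by move=> /H; rewrite mulNr; lra.
  by move=> s /andP[ts _]; have := HT s (le_trans tT ts); lra.
have q0 : 0 < 1 - p (t - tau / 4) by have := front_lt1 F (t - tau / 4); lra.
have kt := Hk t (le_trans t0 tt).
have e0 := expR_gt0 (lambda * (tau / 4)).
have : k * expR (lambda * (tau / 4)) <= 1.
  rewrite -ler_pdivlMr // -(ler_pM2r q0).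
  by move: H kt; rewrite mulNr div1r; lra.
have := expR_ge1Dx (lambda * (tau / 4)) => eg ke.
rewrite ler_pdivlMr ?mulr_gt0 //.
have : k * (1 + lambda * (tau / 4)) <= k * expR (lambda * (tau / 4)).
  by rewrite ler_wpM2l // ltW.
lra.
Qed.

(** Otherwise every multiple of a fixed s > 0 would be a decay rate of 1 - phi. *)
Lemma front_characteristic_root c tau p p1 p2
    (F : increasing_front c tau p p1 p2) (theta : R) : theta < 1 ->
  exists2 mu, 0 <= mu & theta * expR (mu * tau) < mu ^+ 2 + c * mu.
Proof.
move=> th1.
case: (pselect (exists2 mu, 0 <= mu & theta * expR (mu * tau) < mu ^+ 2 + c * mu)) => //.
move=> nmu.
have Hmu mu : 0 <= mu -> mu ^+ 2 + c * mu <= theta * expR (mu * tau).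
  by move=> mu0; rewrite leNgt; apply/negP => lt; apply: nmu; exists mu.
have th0 : 0 <= theta by have := Hmu 0 (lexx 0); rewrite mul0r expR0; lra.
have c0 := front_c_gt0 F; have tau0 := front_tau_gt0 F.
have [M M0 HM] := front_decay_bounded F.
(* For lambda <= M, (lambda + s)^2 + c (lambda + s) exceeds
   lambda^2 + c lambda by at most (1 - theta) / 2, the distance from theta to
   the factor (1 + theta) / 2 kept in front of the exponential. *)
pose s := (1 - theta) / 2 / (2 * M + 1 + c).
have M1 : 0 < 2 * M + 1 + c by lra.
have s0 : 0 < s by rewrite divr_gt0 // divr_gt0 // subr_gt0.
have sM : s * (2 * M + 1 + c) = (1 - theta) / 2 by rewrite /s divfK // gt_eqF.
have s1 : s <= 1.
  by rewrite /s ler_pdivrMr //; lra.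
have S n : exists T, forall t, T <= t -> n%:R * s * (1 - p t) <= p1 t.
  elim: n => [|n IH].
    by exists 0 => t _; rewrite !mul0r; exact: (front_slope_ge0 F).
  have ns0 : 0 <= n%:R * s by rewrite mulr_ge0 // ltW.
  have nM := HM _ ns0 IH.
  apply: (@front_decay_iterate _ _ _ _ _ F ((1 + theta) / 2) (n%:R * s)) => //.
  - lra.
  - by rewrite mulr_ge0 // ltW.
  have e1 : 1 <= expR (n%:R * s * tau).
    by rewrite -[leLHS]expR0 ler_expR mulr_ge0 // ltW.
  have := Hmu _ ns0.
  rewrite -natr1 mulrDl mul1r.
  move: nM e1; set l := n%:R * s; set e := expR _ => lM e1 le.
  have : s * (2 * l + s + c) <= s * (2 * M + 1 + c).
    by apply: ler_wpM2l; [exact: ltW | lra].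
  have : (1 - theta) / 2 * 1 <= (1 - theta) / 2 * e.
    by apply: ler_wpM2l; [lra | exact: e1].
  lra.
have := @archi_boundP R (M / s) ltac:(by rewrite divr_ge0 // ltW).
rewrite ltr_pdivrMr // ltNge => /negP; case.
by apply: HM (S _); rewrite mulr_ge0 // ltW.
Qed.

End Front.

(** * Taylor bounds for the exponential *)

Section ExponentialBounds.
Set Implicit Arguments.
Unset Strict Implicit.
Variable R : realType.

Lemma is_derive_monomial (n : nat) (x : R) :
  is_derive x 1 (fun t => t ^+ n.+1 / n.+1`!%:R) (x ^+ n / n`!%:R).
Proof.
have dX : is_derive x 1 (fun t : R => t ^+ n.+1) ((n.+1%:R * x ^+ n) *: 1).
  by have := is_deriveX n.+1 (is_derive_id x (1 : R)); rewrite exprfctE.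
apply: (is_derive_eq (is_derive_mul dX (is_derive_const (n.+1`!%:R^-1) x))).
rewrite mulr0 addr0 /GRing.scale /= mulr1 factS natrM.
by field; rewrite pnatr_eq0 -lt0n fact_gt0 addrC natr1 pnatr_eq0.
Qed.

Lemma is_derive_exp_partial (n : nat) (x : R) :
  is_derive x 1 (fun t => \sum_(i < n.+2) t ^+ i / i`!%:R)
    (\sum_(i < n.+1) x ^+ i / i`!%:R).
Proof.
elim: n x => [|n IH] x.
  rewrite big_ord_recr big_ord0 /= add0r.
  under eq_fun do rewrite big_ord_recr big_ord_recr big_ord0 /= add0r expr0.
  apply: (is_derive_eq (is_derive_add (is_derive_const _ x) (is_derive_monomial 0 x))).
  by rewrite add0r.
rewrite big_ord_recr /=; under eq_fun do rewrite big_ord_recr /=.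
exact: is_derive_add (IH x) (is_derive_monomial _ x).
Qed.

Lemma exp_partial0 (n : nat) : \sum_(i < n.+1) (0 : R) ^+ i / i`!%:R = 1.
Proof.
rewrite big_ord_recl /= expr0 fact0 divr1 big1 ?addr0 // => i _.
by rewrite exprS !mul0r.
Qed.

(** Integrate the bound of lower degree from 0. *)
Lemma exp_partial_le (n : nat) (x : R) : 0 <= x ->
  \sum_(i < n.+1) x ^+ i / i`!%:R <= expR x.
Proof.
elim: n x => [|n IH] x x0.
  rewrite big_ord_recr big_ord0 /= add0r expr0 fact0 divr1.
  by rewrite -[leLHS]expR0 ler_expR.
have := @ler_of_is_derive R (fun t => \sum_(i < n.+2) t ^+ i / i`!%:R) (@expR R)
  (fun t => \sum_(i < n.+1) t ^+ i / i`!%:R) (@expR R) 0 x x0.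
rewrite exp_partial0 expR0 subrr subr_ge0; apply => t /andP[t0 _].
- exact: is_derive_exp_partial.
- exact: IH.
Qed.

(** Integrate exp <= C over [0, x] n + 1 times. *)
Lemma exp_le_partial (n : nat) (C x : R) : 0 <= x -> expR x <= C ->
  expR x <= \sum_(i < n.+1) x ^+ i / i`!%:R + C * (x ^+ n.+1 / n.+1`!%:R).
Proof.
elim: n x => [|n IH] x x0 eC.
  rewrite big_ord_recr big_ord0 /= add0r expr0 fact0 divr1 expr1 divr1.
  have := @ler_of_is_derive R (@expR R) (fun t => C * t + 1) (@expR R) (fun=> C) 0 x x0.
  rewrite expR0 mulr0 add0r subrr => H.
  suff : 0 <= C * x + 1 - expR x by rewrite subr_ge0 addrC.
  apply: H => t /andP[t0 tx].
  - exact: is_derive_affine.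
  - by apply: le_trans eC; rewrite ler_expR.
have := @ler_of_is_derive R (@expR R)
  (fun t => \sum_(i < n.+2) t ^+ i / i`!%:R + C * (t ^+ n.+2 / n.+2`!%:R)) (@expR R)
  (fun t => \sum_(i < n.+1) t ^+ i / i`!%:R + C * (t ^+ n.+1 / n.+1`!%:R)) 0 x x0.
rewrite exp_partial0 expR0 [in C * (0 ^+ _ / _)]exprS !mul0r mulr0 addr0 subrr subr_ge0.
apply => t /andP[t0 tx].
- apply: is_derive_add; first exact: is_derive_exp_partial.
  exact: is_derive_scale (is_derive_monomial _ t).
- by apply: IH => //; apply: le_trans eC; rewrite ler_expR.
Qed.

(** The Taylor sum with last coefficient C, in Horner form and without
    factorials, so that its instances are small arithmetic expressions; k is the number of
    leading terms already split off. *)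
Fixpoint exp_horner (C x : R) (n k : nat) : R :=
  if n is m.+1 then 1 + x / k.+1%:R * exp_horner C x m k.+1 else C.

Lemma exp_hornerE (C x : R) (n k : nat) :
  \sum_(i < n) x ^+ i * (k`!%:R / (k + i)`!%:R) + C * (x ^+ n * (k`!%:R / (k + n)`!%:R))
  = exp_horner C x n k.
Proof.
have fk m : m`!%:R != 0 :> R by rewrite pnatr_eq0 -lt0n fact_gt0.
elim: n k => [|n IH] k /=.
  by rewrite big_ord0 add0r expr0 addn0 divff // !mulr1.
rewrite -IH big_ord_recl expr0 addn0 divff // mul1r -addrA; congr (_ + _).
rewrite mulrDr mulr_sumr; congr (_ + _).
  apply: eq_bigr => i _; rewrite /= /bump leq0n add1n addSnnS exprS factS natrM.
  by field; rewrite fk addrC natr1 pnatr_eq0.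
rewrite addSnnS exprS (factS k) natrM.
by field; rewrite fk addrC natr1 pnatr_eq0.
Qed.

Lemma exp_horner_le (n : nat) (x : R) : 0 <= x -> exp_horner 1 x n 0 <= expR x.
Proof.
move=> x0; apply: le_trans (exp_partial_le n x0).
rewrite -exp_hornerE big_ord_recr /= add0n fact0 mul1r div1r.
by rewrite lerD2r; apply: ler_sum => i _; rewrite add0n div1r.
Qed.

Lemma exp_le_horner (n : nat) (C x : R) : 0 <= x -> expR x <= C ->
  expR x <= exp_horner C x n.+1 0.
Proof.
move=> x0 eC; apply: le_trans (exp_le_partial n x0 eC) _.
rewrite -exp_hornerE add0n fact0 div1r lerD2r.
by apply: ler_sum => i _; rewrite add0n div1r.
Qed.

Lemma expR_3half_le : expR (3 / 2 : R) <= 8.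
Proof.
have e0 := expR_gt0 (1 / 2 : R).
have e2 : expR (1 / 2 : R) <= 2.
  have := expRxMexpNx_1 (1 / 2 : R).
  have : expR (1 / 2) * (1 + - (1 / 2)) <= expR (1 / 2) * expR (- (1 / 2)) :> R.
    by rewrite ler_wpM2l ?(ltW e0) // expR_ge1Dx.
  lra.
have -> : 3 / 2 = 3%:R * (1 / 2) :> R by field.
rewrite expRM_natl; apply: (@le_trans _ _ (2 ^+ 3)); last by lra.
by rewrite lerXn2r ?nnegrE // ltW.
Qed.

End ExponentialBounds.

(** * The threshold delay *)

Section Threshold.
Set Implicit Arguments.
Unset Strict Implicit.
Variable R : realType.

(** In terms of q, the graphs of exp(z h) and z^2/4 + z are tangent at
    z = 4 q / (1 - q), where h = [delay_of q]. *)
Definition tangency (q : R) : Prop := (1 - q) ^+ 2 * expR (1 + q) = 4 * q.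

(** Inverse of h |-> sqrt(1 + 4 h^2) - 2 h. *)
Definition delay_of (q : R) : R := (1 - q ^+ 2) / (4 * q).

(** Since 1 - d <= exp(- d) with d = r - q, the factor 1 - q decreases at least
    as fast as exp(- q), and only one of the two such factors is needed to
    offset the growth of exp(1 + q). *)
Lemma tangency_mono (q r : R) : 0 < q -> q <= r -> r < 1 ->
  (1 - r) ^+ 2 * expR (1 + r) <= (1 - q) ^+ 2 * expR (1 + q).
Proof.
move=> q0 qr r1.
have e0 := expR_gt0 (r - q).
have e1 : 1 <= expR (r - q) by rewrite -[leLHS]expR0 ler_expR subr_ge0.
have H : (1 - r) * expR (r - q) <= 1 - q.
  have : (1 - (r - q)) * expR (r - q) <= 1.
    rewrite -ler_pdivlMr // div1r -expRN.
    by apply: le_trans (expR_ge1Dx _); lra.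
  have : 0 <= q * (expR (r - q) - 1) by rewrite mulr_ge0; lra.
  lra.
have -> : 1 + r = (1 + q) + (r - q) by ring.
rewrite expRD.
have : ((1 - r) * expR (r - q)) * (1 - r) <= (1 - q) * (1 - q).
  by apply: ler_pM => //; [rewrite mulr_ge0 ?ltW // | |]; lra.
move/(ler_wpM2r (expR_ge0 (1 + q))).
by rewrite !expr2; lra.
Qed.

Lemma tangency_unique (q r : R) : 0 < q < 1 -> 0 < r < 1 ->
  tangency q -> tangency r -> q = r.
Proof.
move=> /andP[q0 q1] /andP[r0 r1] tq tr.
wlog qr : q r q0 q1 r0 r1 tq tr / q <= r.
  by move=> W; case: (leP q r) => [|/ltW] h; [|symmetry]; exact: W.
have := tangency_mono q0 qr r1; rewrite tq tr; lra.
Qed.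

Lemma sqrt_delay_of (q : R) : 0 < q ->
  Num.sqrt (1 + 4 * delay_of q ^+ 2) = (1 + q ^+ 2) / (2 * q).
Proof.
move=> q0.
have -> : 1 + 4 * delay_of q ^+ 2 = ((1 + q ^+ 2) / (2 * q)) ^+ 2.
  by rewrite /delay_of; field; rewrite gt_eqF.
by rewrite sqrtr_sqr ger0_norm // divr_ge0 // ?addr_ge0 ?sqr_ge0 ?mulr_ge0 // ltW.
Qed.

(** The equation of h1 is the tangency equation up to the nonzero factor
    (1 + q)^2 / (8 q^2). *)
Lemma h1_root_delay_of (q : R) : 0 < q < 1 -> h1_root (delay_of q) <-> tangency q.
Proof.
move=> /andP[q0 q1]; rewrite /h1_root (sqrt_delay_of q0).
have -> : 1 + (1 + q ^+ 2) / (2 * q) - 2 * delay_of q = 1 + q.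
  by rewrite /delay_of; field; rewrite gt_eqF.
have h0 : 0 < delay_of q.
  rewrite divr_gt0 //; last lra.
  have : 0 < (1 - q) * (1 + q) by apply: mulr_gt0; lra.
  lra.
have qn : q != 0 by rewrite gt_eqF.
pose k := (1 + q) ^+ 2 / (8 * q ^+ 2).
have k0 : k != 0.
  by rewrite gt_eqF // divr_gt0 ?mulr_gt0 ?exprn_gt0 //; lra.
have E : 2 * delay_of q ^+ 2 * expR (1 + q) - (1 + (1 + q ^+ 2) / (2 * q)) =
    k * ((1 - q) ^+ 2 * expR (1 + q) - 4 * q).
  by rewrite /delay_of /k; field.
rewrite /tangency; split=> [[_ /eqP]|H].
  by rewrite -subr_eq0 E mulf_eq0 (negbTE k0) subr_eq0 => /eqP.
split=> //; apply/eqP; rewrite -subr_eq0 E.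
by rewrite H subrr mulr0.
Qed.

Lemma delay_of_onto (h : R) : 0 < h -> exists2 q, 0 < q < 1 & h = delay_of q.
Proof.
move=> h0; pose s := Num.sqrt (1 + 4 * h ^+ 2).
have h2 : 0 < h ^+ 2 by rewrite exprn_gt0.
have s2 : s ^+ 2 = 1 + 4 * h ^+ 2 by rewrite sqr_sqrtr //; lra.
have s0 : 0 <= s by exact: sqrtr_ge0.
have sh : 2 * h < s by rewrite -(ltr_pXn2r (n := 2)) // ?nnegrE; lra.
have s1 : s < 1 + 2 * h by rewrite -(ltr_pXn2r (n := 2)) // ?nnegrE; lra.
exists (s - 2 * h); first by apply/andP; split; lra.
have qn : s - 2 * h != 0 by rewrite gt_eqF //; lra.
have : 4 * h * (s - 2 * h) = 1 - (s - 2 * h) ^+ 2 by lra.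
rewrite /delay_of => <-; field.
exact: qn.
Qed.

Lemma delay_of_anti (q r : R) : 0 < q -> q <= r -> delay_of r <= delay_of q.
Proof.
move=> q0 qr; have r0 : 0 < r by lra.
rewrite -subr_ge0.
have -> : delay_of q - delay_of r = (r - q) * (1 + q * r) / (4 * q * r).
  by rewrite /delay_of; field; rewrite !gt_eqF.
have qr0 : 0 < q * r by apply: mulr_gt0.
by rewrite divr_ge0 ?mulr_ge0 //; lra.
Qed.

(** With w = 4 q / (1 - q) the abscissa of tangency, multiply the tangent-line
    bounds z / w <= exp(z / w - 1) and
    (z + 4) / (w + 4) <= exp((z + 4) / (w + 4) - 1): the slopes 1 / w and
    1 / (w + 4) add up to [delay_of q]. *)
Lemma tangent_bound (q z : R) : 0 < q < 1 -> tangency q -> 0 <= z ->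
  z ^+ 2 / 4 + z <= expR (z * delay_of q).
Proof.
move=> /andP[q0 q1] tq z0.
have qn : q != 0 by rewrite gt_eqF.
have q1n : 1 - q != 0 by rewrite gt_eqF //; lra.
have q4n : 4 * q + 4 * (1 - q) != 0 by rewrite gt_eqF //; lra.
pose w := 4 * q / (1 - q).
have w0 : 0 < w by rewrite divr_gt0 //; lra.
have h1 : z / w <= expR (z / w - 1).
  by apply: le_trans (expR_ge1Dx _); lra.
have h2 : (z + 4) / (w + 4) <= expR ((z + 4) / (w + 4) - 1).
  by apply: le_trans (expR_ge1Dx _); lra.
have := ler_pM _ _ h1 h2; rewrite -expRD.
have -> : z / w - 1 + ((z + 4) / (w + 4) - 1) = z * delay_of q - (1 + q).
  by rewrite /w /delay_of; field; rewrite qn q1n q4n.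
rewrite expRB.
have e0 := expR_gt0 (1 + q).
have -> : z / w * ((z + 4) / (w + 4)) = (z ^+ 2 / 4 + z) / expR (1 + q).
  have -> : expR (1 + q) = 4 * q / (1 - q) ^+ 2 by rewrite -tq; field.
  by rewrite /w; field; rewrite qn q1n q4n.
rewrite ler_pM2r ?invr_gt0 //; apply; rewrite divr_ge0 //; lra.
Qed.

(** This rational and that of the next lemma bracket the root, about
    0.3810744559, tightly enough to fix the ninth decimal of the delay.  The two
    sides differ by about 2e-9 here and 7e-10 there. *)
Lemma tangency_lo (q : R) : q = 381/10^+3 + 74/10^+6 + 455/10^+9 + 600/10^+12 ->
  4 * q <= (1 - q) ^+ 2 * expR (1 + q).
Proof.
move=> qE; have : 0 <= 1 + q by rewrite qE; lra.
move=> /(exp_horner_le 14); cbn [exp_horner].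
have : 0 < (1 - q) ^+ 2 by rewrite exprn_gt0 // qE; lra.
move=> q0 /(ler_wpM2l (ltW q0)); apply: le_trans.
rewrite qE; lra.
Qed.

(** With 15 terms, even the crude constant 8 in the remainder costs only about
    3e-10. *)
Lemma tangency_hi (q : R) : q = 381/10^+3 + 74/10^+6 + 456/10^+9 ->
  (1 - q) ^+ 2 * expR (1 + q) <= 4 * q.
Proof.
move=> qE; have q1 : 0 <= 1 + q by rewrite qE; lra.
have : expR (1 + q) <= 8.
  by apply: le_trans (expR_3half_le R); rewrite ler_expR qE; lra.
move=> /(exp_le_horner 14 q1); cbn [exp_horner].
have : 0 < (1 - q) ^+ 2 by rewrite exprn_gt0 // qE; lra.
move=> q0 /(ler_wpM2l (ltW q0)) /le_trans; apply.
rewrite qE; lra.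
Qed.

Lemma tangency_root : exists q : R,
  [/\ 0 < q < 1, tangency q,
      560 / 10 ^+ 3 + 771 / 10 ^+ 6 + 160 / 10 ^+ 9 <= delay_of q &
      delay_of q < 560 / 10 ^+ 3 + 771 / 10 ^+ 6 + 161 / 10 ^+ 9].
Proof.
set a : R := 381/10^+3 + 74/10^+6 + 455/10^+9 + 600/10^+12.
set b : R := 381/10^+3 + 74/10^+6 + 456/10^+9.
have ab : a <= b by rewrite /a /b; lra.
pose G (q : R) := (-1 * q + 1) * (-1 * q + 1) * expR (1 * q + 1) - 4 * q.
have GE q : G q = (1 - q) ^+ 2 * expR (1 + q) - 4 * q.
  by rewrite /G mul1r (addrC q 1); ring.
have cG : continuous G.
  move=> x; apply: differentiable_continuous; apply/derivable1_diffP.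
  have d1 := is_derive_affine (- 1) 1 x.
  have de := is_derive_comp_affine (is_derive_expR (1 * x + 1)).
  have d4 := is_derive_scale 4 (is_derive_id x (1 : R)).
  have dG := is_derive_sub (is_derive_mul (is_derive_mul d1 d1) de) d4.
  exact: (@ex_derive _ _ _ _ _ _ _ dG).
have [||q qab Gq] := @IVT R G a b 0 ab.
- exact: continuous_subspaceT.
- have Ga : 0 <= G a by rewrite GE subr_ge0; exact: tangency_lo.
  have Gb : G b <= 0 by rewrite GE subr_le0; exact: tangency_hi.
  by rewrite ge_min le_max Ga Gb orbT.
move: qab; rewrite in_itv /= => /andP[aq qb].
have a0 : 0 < a by rewrite /a; lra.
have b1 : b < 1 by rewrite /b; lra.
have q0 : 0 < q by exact: lt_le_trans aq.
exists q; split.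
- by rewrite q0 (le_lt_trans qb).
- by apply/eqP; rewrite -subr_eq0 -GE; apply/eqP.
- apply: le_trans (delay_of_anti q0 qb).
  rewrite /delay_of ler_pdivlMr; last by rewrite /b; lra.
  by rewrite /b; lra.
- apply: le_lt_trans (delay_of_anti a0 aq) _.
  rewrite /delay_of ltr_pdivrMr; last by rewrite /a; lra.
  by rewrite /a; lra.
Qed.

End Threshold.

(** * From wavefronts to profiles *)

Section Wavefront.
Set Implicit Arguments.
Unset Strict Implicit.
Variable R : realType.

Section Ridge.
Variables (m : nat) (nu : 'rV[R]_m).

Lemma dotDZ (k : R) (v x : 'rV[R]_m) : dot nu (k *: v + x) = k * dot nu v + dot nu x.
Proof.
rewrite /dot mulr_sumr -big_split; apply: eq_bigr => i _ /=.
by rewrite !mxE; ring.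
Qed.

Lemma dot0 : dot nu 0 = 0.
Proof. by rewrite /dot big1 // => i _; rewrite mxE mulr0. Qed.

Lemma dot_delta (i : 'I_m) : dot nu (delta_mx 0 i) = nu 0 i.
Proof.
rewrite /dot (bigD1 i) //= big1 ?addr0 => [|j ji]; rewrite mxE eqxx /=.
  by rewrite eqxx mulr1.
by rewrite (negbTE ji) mulr0.
Qed.

(** Along a line, a plane wave is a function of one real variable, and the
    difference quotients agree. *)
Lemma ridge_quotient (g : R -> R) (b : R) (v x : 'rV[R]_m) :
  (fun h : R => h^-1 *: (((fun y => g (dot nu y + b)) \o shift x) (h *: v)
     - g (dot nu x + b))) =
  (fun h : R => h^-1 *: (((fun s : R => g (dot nu v * s + (dot nu x + b))) \o shift 0)
     (h *: 1) - g (dot nu v * 0 + (dot nu x + b)))).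
Proof.
apply/funext => h /=; rewrite dotDZ mulr0 add0r addr0 /GRing.scale /= mulr1.
by rewrite (mulrC h) addrA.
Qed.

Lemma derive_ridge (g : R -> R) (b a : R) (v x : 'rV[R]_m) :
  is_derive (dot nu x + b) 1 g a ->
  'D_v (fun y => g (dot nu y + b)) x = dot nu v * a.
Proof.
move=> ga; rewrite /derive ridge_quotient.
have := @is_derive_comp_affine R g (dot nu v) (dot nu x + b) 0 a.
by rewrite mulr0 add0r => /(_ ga) [_ <-]; rewrite /derive mulr0 add0r.
Qed.

(** A plane wave differentiable along a direction not tangent to its wavefronts
    has a differentiable profile: this is where the regularity of the profile
    comes from. *)
Lemma derivable_of_ridge (g : R -> R) (b : R) (v x : 'rV[R]_m) :
  dot nu v != 0 -> derivable (fun y => g (dot nu y + b)) x v ->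
  derivable g (dot nu x + b) 1.
Proof.
move=> v0; rewrite /derivable ridge_quotient.
set d := dot nu x + b; set k := dot nu v in v0 *.
move=> H; have {H} : derivable (fun s : R => g (k * s + d)) 0 1 by [].
move=> /derivableP dk.
have E : k^-1 * d + - (k^-1 * d) = 0 by rewrite subrr.
rewrite -E in dk.
have dg := is_derive_comp_affine dk.
have gE : (fun t => g (k * (k^-1 * t + - (k^-1 * d)) + d)) = g.
  by apply/funext => t; congr g; field.
by rewrite gE in dg; exact: (@ex_derive _ _ _ _ _ _ _ dg).
Qed.

End Ridge.

Lemma wavefront_profile (m : nat) (h : R) (u : R -> 'rV[R]_m -> R)
    (nu : 'rV[R]_m) (c : R) (phi : R -> R) :
  0 < h -> kpp_wavefront h u nu c phi -> monotone_profile phi ->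
  increasing_front c (c * h) phi ('D_1 phi) ('D_1 ('D_1 phi)).
Proof.
move=> h0 [[C12 _ eq] uE nu1 c0 pos left right] mono.
have {}uE : u = fun t x => phi (dot nu x + c * t).
  by apply/funext => t; apply/funext => x; exact: uE.
subst u.
have cn : c != 0 by rewrite gt_eqF.
have zE (z : R) : dot nu 0 + c * (z / c) = z by rewrite dot0 add0r mulrC divfK.
have nunu : \sum_(i < m) nu 0 i * nu 0 i = 1.
  have d0 : 0 <= dot nu nu by apply: sumr_ge0 => i _; rewrite -expr2 sqr_ge0.
  by rewrite -[LHS](sqr_sqrtr d0) -[Num.sqrt _]/(enorm nu) nu1 expr1n.
(* Some coordinate direction is transverse to the wavefronts. *)
have [j nuj] : exists j, nu 0 j != 0.
  apply: contrapT => /forallNP nu0; move: nunu; rewrite big1 => [/eqP|i _].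
    by rewrite eq_sym oner_eq0.
  by move/negP: (nu0 i); rewrite negbK => /eqP ->; rewrite mul0r.
have d1 (z : R) : is_derive z 1 phi ('D_1 phi z).
  apply/derivableP; rewrite -[z]zE.
  apply: (@derivable_of_ridge _ _ _ _ (delta_mx 0 j)); first by rewrite dot_delta.
  exact: (@C12_ex_dx _ _ _ C12 (z / c) 0 j).
have partialE (t : R) (i : 'I_m) : partial i (fun x => phi (dot nu x + c * t)) =
    fun x => nu 0 i * 'D_1 phi (dot nu x + c * t).
  apply/funext => x; rewrite /partial (derive_ridge _ (d1 _)).
  by rewrite dot_delta.
have d2 (z : R) : is_derive z 1 ('D_1 phi) ('D_1 ('D_1 phi) z).
  apply/derivableP; rewrite -[z]zE.
  have := @C12_ex_dxx _ _ _ C12 (z / c) 0 j j; rewrite partialE.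
  move/(@derivable_of_ridge _ _ (fun z => nu 0 j * 'D_1 phi z)).
  rewrite dot_delta => /(_ nuj) /derivableP dk.
  have dg := is_derive_scale (nu 0 j)^-1 dk.
  rewrite (_ : (fun t => _) = 'D_1 phi) in dg; last first.
    by apply/funext => t; rewrite mulKf.
  exact: (@ex_derive _ _ _ _ _ _ _ dg).
have lapE (t : R) x : laplacian (fun x => phi (dot nu x + c * t)) x =
    'D_1 ('D_1 phi) (dot nu x + c * t).
  rewrite /laplacian -[RHS]mul1r -[X in _ = X * _]nunu mulr_suml; apply: eq_bigr => i _.
  rewrite partialE /partial.
  rewrite (derive_ridge _ (is_derive_scale (nu 0 i) (d2 _))) dot_delta.
  by rewrite mulrA.
have dtE (t : R) x : dt (fun t x => phi (dot nu x + c * t)) t x =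
    c * 'D_1 phi (dot nu x + c * t).
  rewrite /dt; have := d1 (c * t + dot nu x) => /is_derive_comp_affine [_].
  by rewrite (addrC (c * t)) => <-; congr ('D_1 _ t); apply/funext => s; rewrite addrC.
split => //.
- by rewrite mulr_gt0.
- move=> z; have := eq (z / c) 0; rewrite dtE lapE zE.
  have -> : dot nu 0 + c * (z / c - h) = z - c * h by rewrite mulrBr addrA zE.
  lra.
- case: mono => // anti.
  have [M [_ Mp]] := @cvgr_lt _ _ _ _ _ _ left _ (pos 0).
  have := Mp (Num.min (M - 1) 0).
  rewrite gt_min; have -> : M - 1 < M by lra.
  move=> /(_ isT); rewrite ltNge => /negP; case.
  by apply: anti; rewrite ge_min lexx orbT.
Qed.

(** The factor theta absorbs exp(- z (h - h1)) for z >= 1/2; for smaller z the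
    polynomial z^2/4 + z is at most 9/16. *)
Lemma no_increasing_front (h c q : R) (p p1 p2 : R -> R) :
  0 < q < 1 -> tangency q -> delay_of q < h ->
  ~ increasing_front c (c * h) p p1 p2.
Proof.
move=> q01 tq hq F.
have c2 := front_speed_ge2 F.
have c0 := front_c_gt0 F.
pose theta := Num.max (9 / 16) (expR (- ((h - delay_of q) / 2))).
have th1 : theta < 1.
  by rewrite gt_max expR_lt1; apply/andP; split; lra.
have [mu mu0] := front_characteristic_root F th1.
apply/negP; rewrite -leNgt.
pose z := c * mu.
have z0 : 0 <= z by rewrite mulr_ge0 // ltW.
have -> : mu * (c * h) = z * h by rewrite /z; ring.
apply: (@le_trans _ _ (z ^+ 2 / 4 + z)).
  have : 0 <= mu ^+ 2 * ((c - 2) * (c + 2)).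
    by rewrite mulr_ge0 ?sqr_ge0 // mulr_ge0; lra.
  by rewrite /z; lra.
have e0 := expR_gt0 (z * h).
have [z2|z2] := leP z (1 / 2).
  have hpos : 0 < delay_of q.
    by have /h1_root_delay_of/iffRL/(_ tq)[] := q01.
  apply: (@le_trans _ _ (9 / 16 * expR (z * h))); last first.
    by rewrite ler_wpM2r ?(ltW e0) // /theta le_max lexx.
  have : 1 <= expR (z * h) by rewrite -[leLHS]expR0 ler_expR mulr_ge0 //; lra.
  have : 0 <= z * (1 / 2 - z) by rewrite mulr_ge0 //; lra.
  lra.
apply: le_trans (tangent_bound q01 tq z0) _.
apply: (@le_trans _ _ (expR (- ((h - delay_of q) / 2)) * expR (z * h))); last first.
  by rewrite ler_wpM2r ?(ltW e0) // /theta le_max lexx orbT.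
rewrite -expRD ler_expR.
have : 0 <= (z - 1 / 2) * (h - delay_of q) by rewrite mulr_ge0 //; lra.
lra.
Qed.

End Wavefront.

Theorem corollary5 (R : realType) :
  exists h1 : R,
    [/\ unique (@h1_root R) h1,
        560 / 10 ^+ 3 + 771 / 10 ^+ 6 + 160 / 10 ^+ 9 <= h1,
        h1 < 560 / 10 ^+ 3 + 771 / 10 ^+ 6 + 161 / 10 ^+ 9
      & forall (h : R) (m : nat), h1 < h -> (1 <= m)%N ->
          ~ has_monotone_wavefront m h].
Proof.
have [q [q01 tq lo hi]] := tangency_root R.
have rq : h1_root (delay_of q) by apply/h1_root_delay_of.
exists (delay_of q); split => // [|h m hq _].
  split=> // h hr.
  have [r r01 hE] := delay_of_onto (proj1 hr).
  rewrite hE in hr *; congr delay_of.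
  by apply: tangency_unique => //; apply/h1_root_delay_of.
move=> [u [nu [c [phi [front mono]]]]].
have h0 : 0 < h by exact: lt_trans (proj1 rq) hq.
exact: no_increasing_front q01 tq hq (wavefront_profile h0 front mono).
Qed.
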